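(* Let a finite-horizon MDP, its optimal value functions $V_h^\star$, the optimal martingale functions $\eta_{t+1}^\star$, the estimated martingale functions $\widetilde\eta_{t+1}$, and the dual upper bound $V_0^{\mathrm{up}}(x;\widetilde{\boldsymbol\xi})$ with its Monte Carlo estimate $V_{0,N_{\mathrm{test}}}^{\mathrm{up}}(x;\widetilde{\boldsymbol\xi})$ be as described in the context, and suppose that assumptions (B1)--(B4) of the context hold. Then for every $x\in\mathsf S$, $$ V_0^{\mathrm{up}}(x;\widetilde{\boldsymbol\xi})-V_0^\star(x)\le\sum_{t=0}^{H-1}\mathbb E_x\Bigl[\sup_{(y,a)\in\mathsf S\times\mathsf A}\bigl|\eta_{t+1}^\star(y,a)-\widetilde\eta_{t+1}(y,a)\bigr|^2\Bigr]^{1/2}, $$ and, for every $N_{\mathrm{test}}\ge1$, $$ \mathbb E_x\Bigl[\bigl|V_{0,N_{\mathrm{test}}}^{\mathrm{up}}(x;\widetilde{\boldsymbol\xi})-V_0^\star(x)\bigr|^2\Bigr]^{1/2}\le\Bigl(\frac1{\sqrt{N_{\mathrm{test}}}}+1\Bigr)\sum_{t=0}^{H-1}\mathbb E_x\Bigl[\sup_{(y,a)\in\mathsf S\times\mathsf A}\bigl|\eta_{t+1}^\star(y,a)-\widetilde\eta_{t+1}(y,a)\bigr|^2\Bigr]^{1/2}. $$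
   Context: **MDP.** $\mathsf S$ (states) and $\mathsf A$ (actions) are measurable spaces, finite or infinite; $H\ge1$ is the horizon; $P_h(\cdot|x,a)$, $h=1,\dots,H$, are transition kernels from $\mathsf S\times\mathsf A$ to $\mathsf S$; $R_h:\mathsf S\times\mathsf A\to\mathbb R$, $h=0,\dots,H-1$, are rewards; $F:\mathsf S\to\mathbb R$ is the terminal reward. A policy is $\boldsymbol\pi=(\pi_0,\dots,\pi_{H-1})$ with $\pi_t:\mathsf S\to\mathcal P(\mathsf A)$; under $\boldsymbol\pi$, $A_t\sim\pi_t(S_t)$ and $S_{t+1}\sim P_{t+1}(\cdot|S_t,A_t)$. The optimal value functions are $V_h^\star(x):=\sup_{\boldsymbol\pi}\mathbb E_{\boldsymbol\pi}\bigl[\sum_{t=h}^{H-1}R_t(S_t,A_t)+F(S_H)\,|\,S_h=x\bigr]$; they satisfy $V_H^\star=F$ and $V_h^\star(x)=\sup_{a\in\mathsf A}(R_h(x,a)+P_{h+1}^aV_{h+1}^\star(x))$, where $P_{h+1}^aV(x):=\mathbb E_{S'\sim P_{h+1}(\cdot|x,a)}[V(S')]$. Suprema over uncountable families of random variables are understood as essential suprema. $|\cdot|$ is the Euclidean norm and $|\cdot|_\infty$ the $\ell_\infty$ norm. **Assumptions.** (B1) There are a measurable space $\mathsf E$, a probability measure $\mathcal P_{\mathsf E}$ on it, and measurable maps $\mathcal K_h:\mathsf S\times\mathsf A\times\mathsf E\to\mathsf S$, such that the chain is $S_t=\mathcal K_t(S_{t-1},a_{t-1},\varepsilon_t)$ with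 $\varepsilon_t$ i.i.d. $\sim\mathcal P_{\mathsf E}$; thus $P_h^af(x)=\mathbb E_{\varepsilon\sim\mathcal P_{\mathsf E}}[f(\mathcal K_h(x,a,\varepsilon))]$. Moreover $\mathsf S,\mathsf A$ carry metrics $\rho_{\mathsf S},\rho_{\mathsf A}$, $\mathsf S\times\mathsf A$ carries the metric $\rho((x,a),(x',a'))=\Vert(\rho_{\mathsf S}(x,x'),\rho_{\mathsf A}(a,a'))\Vert$ for a fixed norm on $\mathbb R^2$, and for a constant $L_{\mathcal K}$ independent of $h$, $\rho_{\mathsf S}(\mathcal K_h(x,a,\varepsilon),\mathcal K_h(x',a',\varepsilon))\le L_{\mathcal K}\,\rho((x,a),(x',a'))$ for all $(x,a),(x',a'),\varepsilon$. (B2) $|R_h(x,a)|\le R_{\max}$ and $|F(x)|\le R_{\max}$ for all $x,a,h$, and $\sup_{a}|R_h(x,a)-R_h(x',a)|\le L_R\,\rho_{\mathsf S}(x,x')$, with $R_{\max},L_R$ independent of $h$. (B3) The primal basis $\boldsymbol\gamma_{K_{\mathrm{pr}}}=(\gamma_1,\dots,\gamma_{K_{\mathrm{pr}}})^\top$, $\gamma_k:\mathsf S\to\mathbb R$, and probability measures $\mu_h$ on $\mathsf S$ (with $P_h(\cdot|x,a)$ absolutely continuous w.r.t. $\mu_h$ for all $h\in\{1,\dots,H\}$, $x$, $a$) are such that $\Sigma_{h,K_{\mathrm{pr}}}:=\mathbb E_{X\sim\mu_h}[\boldsymbol\gamma_{K_{\mathrm{pr}}}(X)\boldsymbol\gamma_{K_{\mathrm{pr}}}^\top(X)]$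 is invertible, $|\Sigma_{h,K_{\mathrm{pr}}}^{-1}\boldsymbol\gamma_{K_{\mathrm{pr}}}(x)|_\infty\le\Lambda_{K_{\mathrm{pr}}}$ for all $x\in\mathsf S$, $h\in\{0,\dots,H-1\}$, and $|\boldsymbol\gamma_{K_{\mathrm{pr}}}(x)-\boldsymbol\gamma_{K_{\mathrm{pr}}}(x')|\le L_{\gamma,K_{\mathrm{pr}}}\,\rho_{\mathsf S}(x,x')$ with $L_{\gamma,K_{\mathrm{pr}}}>0$. (B4) $\boldsymbol\psi_K=(\psi_1,\dots,\psi_K)^\top$ with $\psi_k\in L^2(\mathsf E,\mathcal P_{\mathsf E})$, $\int\psi_k\,d\mathcal P_{\mathsf E}=0$; $\Sigma_{\mathsf E,K}:=\mathbb E_{\varepsilon\sim\mathcal P_{\mathsf E}}[\boldsymbol\psi_K(\varepsilon)\boldsymbol\psi_K^\top(\varepsilon)]$ is invertible; $|\Sigma_{\mathsf E,K}^{-1}\boldsymbol\psi_K(\varepsilon)|_\infty\le\Lambda_{\mathsf E,K}$ for all $\varepsilon\in\mathsf E$; and $\mathbb E_{\varepsilon\sim\mathcal P_{\mathsf E}}[|\boldsymbol\psi_K(\varepsilon)|^2]\le\varrho_{\psi,K}^2$. **Primal algorithm.** $\widetilde L_h:=(H-h+1)R_{\max}$, $V_{\max}^\star:=(H+1)R_{\max}$, $L_{V,K_{\mathrm{pr}}}:=L_R+V_{\max}^\star\Lambda_{K_{\mathrm{pr}}}L_{\gamma,K_{\mathrm{pr}}}\sqrt{K_{\mathrm{pr}}}$,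 $\mathcal T_L[g](x):=\max(-L,\min(L,g(x)))$. Draw independent pairs $(X_i^h,\varepsilon_i^h)\sim\mu_h\otimes\mathcal P_{\mathsf E}$, $h=0,\dots,H-1$, $i=1,\dots,N$. Set $V_{H,N}:=F$ and, backwards for $h=H-1,\dots,0$, $$V_{h,N}(x):=\sup_{a\in\mathsf A}\bigl(R_h(x,a)+\mathcal T_{\widetilde L_{h+1}}[\beta_{N,a}^\top\boldsymbol\gamma_{K_{\mathrm{pr}}}](x)\bigr),\quad \beta_{N,a}:=\frac1N\sum_{i=1}^N V_{h+1,N}(Y_i^a)\,\Sigma_{h,K_{\mathrm{pr}}}^{-1}\boldsymbol\gamma_{K_{\mathrm{pr}}}(X_i^h),$$ with $Y_i^a:=\mathcal K_{h+1}(X_i^h,a,\varepsilon_i^h)$. **Estimated martingale functions.** For each $t\in\{0,\dots,H-1\}$ draw $\widetilde\varepsilon_1^{t+1},\dots,\widetilde\varepsilon_M^{t+1}$ i.i.d. $\sim\mathcal P_{\mathsf E}$, independent of everything else, and set $$[c_{1,M}(x,a),\dots,c_{K,M}(x,a)]^\top:=\frac1M\sum_{m=1}^M V_{t+1,N}(\mathcal K_{t+1}(x,a,\widetilde\varepsilon_m^{t+1}))\,\Sigma_{\mathsf E,K}^{-1}\boldsymbol\psi_K(\widetilde\varepsilon_m^{t+1}).$$ Let $\mathsf S_L\subset\mathsf S$, $\mathsf A_L\subset\mathsf A$ be fixed grids of $L$ points. For an $\mathcal L$-Lipschitz $f$ on $(\mathsf S\times\mathsf A,\rho)$ set $I[f]:=(H_f^{\mathrm{low}}+H_f^{\mathrm{up}})/2$,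 $H_f^{\mathrm{low}}(x,a):=\max_{(x',a')\in\mathsf S_L\times\mathsf A_L}(f(x',a')-\mathcal L\rho((x,a),(x',a')))$, $H_f^{\mathrm{up}}(x,a):=\min_{(x',a')\in\mathsf S_L\times\mathsf A_L}(f(x',a')+\mathcal L\rho((x,a),(x',a')))$. Set $\widetilde c_{k,M}:=I[c_{k,M}]$ (with $\mathcal L=L_{V,K_{\mathrm{pr}}}L_{\mathcal K}\Lambda_{\mathsf E,K}$) and $\widetilde\eta_{t+1}(x,a)\equiv\widetilde\eta_{t+1}(x,a,\varepsilon_{t+1}):=\sum_{k=1}^K\widetilde c_{k,M}(x,a)\psi_k(\varepsilon_{t+1})$. **Optimal martingale functions.** $\eta_{t+1}^\star(x,a)\equiv\eta_{t+1}^\star(x,a,\varepsilon_{t+1}):=V_{t+1}^\star(\mathcal K_{t+1}(x,a,\varepsilon_{t+1}))-\mathbb E_{\varepsilon\sim\mathcal P_{\mathsf E}}[V_{t+1}^\star(\mathcal K_{t+1}(x,a,\varepsilon))]$. **Upper bound and its estimate.** The noise sequence $(\varepsilon_t)_{t=1}^H$, i.i.d. $\sim\mathcal P_{\mathsf E}$, is independent of all primal and dual simulations. For $a_{\ge0}=(a_0,\dots,a_{H-1})\in\mathsf A^H$ and $a_{<t}=(a_0,\dots,a_{t-1})$, let $S_0=x$, $S_t(a_{<t})=\mathcal K_t(S_{t-1}(a_{<t-1}),a_{t-1},\varepsilon_t)$. With $\widetilde{\boldsymbol\xi}:=(\widetilde\eta_{t+1}(S_t(a_{<t}),a_t))_{t=0,\dots,H-1}$,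 $$V_0^{\mathrm{up}}(x;\widetilde{\boldsymbol\xi}):=\mathbb E_x\Bigl[\sup_{a_{\ge0}\in\mathsf A^H}\Bigl(\sum_{t=0}^{H-1}\bigl(R_t(S_t(a_{<t}),a_t)-\widetilde\eta_{t+1}(S_t(a_{<t}),a_t)\bigr)+F(S_H(a_{<H}))\Bigr)\Bigr],$$ where $\mathbb E_x$ is the overall expectation (over the primal and dual pre-simulations and the independently simulated noise driving the trajectories). Given independent copies $(\varepsilon_t^{(n)})_{t=1}^H$, $n=1,\dots,N_{\mathrm{test}}$, of the noise sequence, independent of the pre-simulations, $V_{0,N_{\mathrm{test}}}^{\mathrm{up}}(x;\widetilde{\boldsymbol\xi})$ is the average over $n$ of $$\sup_{a_{\ge0}\in\mathsf A^H}\Bigl(\sum_{t=0}^{H-1}\bigl(R_t(S_t^{(n)}(a_{<t}),a_t)-\widetilde\eta_{t+1}(S_t^{(n)}(a_{<t}),a_t)\bigr)+F(S_H^{(n)}(a_{<H}))\Bigr),$$ where $S^{(n)}$ and $\widetilde\eta_{t+1}$ are evaluated with $\varepsilon^{(n)}$ in place of $\varepsilon$ (the functions $\widetilde c_{k,M}$ being the same for all $n$).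
   Formalization: Essential suprema of families of random variables are taken with one exceptional null set for the whole family (the pointwise supremum whenever it is measurable); with a null set depending on the index the second inequality can fail. *)

(* Defs.v *)
From HB Require Import structures.
From mathcomp Require Import all_boot all_order all_algebra.
From mathcomp Require Import all_classical all_reals all_analysis.
From mathcomp Require Import measurable_realfun.

Set Implicit Arguments.
Unset Strict Implicit.
Unset Printing Implicit Defensive.

Import Order.TTheory GRing.Theory Num.Theory.
Import numFieldNormedType.Exports.

Local Open Scope classical_set_scope.
Local Open Scope ring_scope.

Section general.
Context {R : realType}.

Definition is_metric (T : Type) (d : T -> T -> R) : Prop :=
  [/\ forall x y, d x y = 0 <-> x = y,
      forall x y, d x y = d y x &
      forall x y z, d x z <= d x y + d y z].

Definition is_norm2 (n : R -> R -> R) : Prop :=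
  [/\ forall x y, n x y = 0 -> x = 0 /\ y = 0,
      forall c x y, n (c * x) (c * y) = `|c| * n x y &
      forall x y x' y', n (x + x') (y + y') <= n x y + n x' y'].

(* The library norm on 'cV[R]_k is the sup norm; this is the Euclidean one. *)
Definition enorm k (v : 'cV[R]_k) : R := Num.sqrt (\sum_(i < k) v i 0 ^+ 2).

End general.

Section product_of_probabilities.
Context {d} {T : measurableType d} {R : realType}.

Definition tuple_cons n (z : T * n.-tuple T) : n.+1.-tuple T :=
  [tuple of z.1 :: z.2].

Lemma measurable_tuple_cons n : measurable_fun setT (@tuple_cons n).
Proof. exact: (@measurable_cons _ _ _ _ fst n snd). Qed.

HB.instance Definition _ n :=
  isMeasurableFun.Build _ _ _ _ (@tuple_cons n) (@measurable_tuple_cons n).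

(* The law of n independent draws, the i-th one from p i. *)
Fixpoint prodP n : ('I_n -> probability T R) -> probability (n.-tuple T) R :=
  match n with
  | 0 => fun _ => \d_ [tuple]
  | n'.+1 => fun p =>
      distribution (p ord0 \x prodP (fun i => p (lift ord0 i)))%E
        (@tuple_cons n')
  end.

Definition iidP n (p : probability T R) : probability (n.-tuple T) R :=
  prodP (fun _ : 'I_n => p).

Lemma prodP_box n (p : 'I_n -> probability T R) (B : 'I_n -> set T) :
  (forall i, measurable (B i)) ->
  prodP p [set w | forall i, B i (tnth w i)] = (\prod_(i < n) p i (B i))%E.
Proof.
elim: n p B => [|n IH] p B mB.
  by rewrite big_ord0 /= diracE mem_set// => -[].
rewrite [RHS]big_ord_recl /= /distribution /pushforward.
rewrite -(IH (fun i => p (lift ord0 i)) (fun i => B (lift ord0 i))); last first.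
  by move=> i; exact: mB.
rewrite -product_measure1E//; last first.
  rewrite (_ : mkset _ = \bigcap_(i in [set: 'I_n])
      ((fun w => tnth w i) @^-1` B (lift ord0 i))).
    apply: fin_bigcap_measurable => // i _.
    by rewrite -[X in measurable X]setTI; apply: measurable_tnth.
  apply/seteqP; split=> w /= Hw i; last exact: (Hw i I).
  by move=> _; exact: Hw.
congr (_ _); apply/seteqP; split=> -[a w] /=.
  move=> Hw; split; first by have := Hw ord0.
  by move=> i; have := Hw (lift ord0 i); rewrite tnthS.
move=> [Ha Hw] i; case: (unliftP ord0 i) => [j|] ->; first by rewrite tnthS.
by [].
Qed.

End product_of_probabilities.

Section essential_supremum_of_a_family.
Context {d} {T : measurableType d} {R : realType}.
Variable P : {measure set T -> \bar R}.

(* g is the essential supremum of (f i)_i: the least random variable that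
   almost surely dominates all the f i, with one exceptional null set for the
   whole family.  It is the pointwise supremum whenever that is measurable
   (is_esssup_ereal_sup).  If the null set could depend on i, the supremum of
   the pathwise dual objective over an uncountable set of action sequences,
   taken with the optimal martingale functions, could be smaller than the
   optimal value. *)
Definition is_esssup (I : Type) (f : I -> T -> \bar R) (g : T -> \bar R) :=
  [/\ measurable_fun [set: T] g,
      {ae P, forall w, forall i, (f i w <= g w)%E} &
      forall g', measurable_fun [set: T] g' ->
        {ae P, forall w, forall i, (f i w <= g' w)%E} ->
        {ae P, forall w, (g w <= g' w)%E}].

Definition esssup (I : Type) (f : I -> T -> \bar R) : T -> \bar R :=
  xget (fun=> +oo%E) [set g | is_esssup f g].

Lemma is_esssup_ereal_sup (I : Type) (f : I -> T -> \bar R) :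
  let g w := ereal_sup [set f i w | i in [set: I]] in
  measurable_fun [set: T] g -> is_esssup f g.
Proof.
move=> g mg; split => // [|g' mg' [X [mX X0 subX]]].
  by apply: aeW => w i; apply: ereal_sup_ubound; exists i.
exists X; split=> // w /= ngg'; apply: subX => /= fg'; apply: ngg'.
by apply: ge_ereal_sup => _ [i _ <-]; exact: fg'.
Qed.

End essential_supremum_of_a_family.

(* Time-indexed families are indexed by nat; only trans h for 1 <= h <= horizon
   and reward h for h < horizon matter. *)
Record mdp {R : realType} {dS dA} {S : measurableType dS}
    {A : measurableType dA} := Mdp {
  horizon : nat;
  horizon_gt0 : (0 < horizon)%N;
  trans : nat -> R.-pker (S * A) ~> S;
  reward : nat -> S -> A -> R;
  measurable_reward : forall h,
    measurable_fun setT (fun z : S * A => reward h z.1 z.2);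
  terminal : S -> R;
  measurable_terminal : measurable_fun setT terminal }.
Arguments mdp : clear implicits.
Arguments mdp R {dS dA} S A.

Section optimal_values.
Context {R : realType} {dS dA} {S : measurableType dS} {A : measurableType dA}.
Variable m : mdp R S A.

Definition policy := nat -> R.-pker S ~> A.

(* The expectation, under the policy pi and given S_h = x, of
   G [:: (S_h, A_h); ...; (S_(h+n-1), A_(h+n-1))] S_(h+n), as an iterated
   integral. *)
Fixpoint traj_exp (pi : policy) (n h : nat) (x : S)
    (G : seq (S * A) -> S -> R) : R :=
  if n is n'.+1 then
    \int[pi h x]_a \int[trans m h.+1 (x, a)]_y
      traj_exp pi n' h.+1 y (fun s z => G ((x, a) :: s) z)
  else G [::] x.

Fixpoint rewards (h : nat) (s : seq (S * A)) : R :=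
  if s is z :: s' then reward m h z.1 z.2 + rewards h.+1 s' else 0.

Definition policy_value (pi : policy) (h : nat) (x : S) : R :=
  traj_exp pi (horizon m - h) h x (fun s z => rewards h s + terminal m z).

Definition Vstar (h : nat) (x : S) : R :=
  sup [set policy_value pi h x | pi in [set: policy]].

Definition P_op (h : nat) (V : S -> R) (x : S) (a : A) : R :=
  \int[trans m h (x, a)]_y V y.

(* On general measurable spaces, measurability of the optimal values and the
   Bellman equation are not consequences of the definition of Vstar: they need
   measurable near-optimal selections. *)
Definition dynamic_programming : Prop :=
  (forall h, (h <= horizon m)%N -> measurable_fun setT (Vstar h)) /\
  (forall h x, (h < horizon m)%N ->
     Vstar h x = sup [set reward m h x a + P_op h.+1 (Vstar h.+1) x a
                     | a in [set: A]]).

End optimal_values.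

(* noise is the law of the innovations, next h is K_h, gam and psi are the
   primal and dual bases, ref h is mu_h, and N, M, L are the numbers of primal
   samples, dual samples and grid points. *)
Record setup {R : realType} {dS dA dE} {S : measurableType dS}
    {A : measurableType dA} {E : measurableType dE} := Setup {
  noise : probability E R;
  next : nat -> S -> A -> E -> S;
  distS : S -> S -> R;
  distA : A -> A -> R;
  norm2 : R -> R -> R;
  L_K : R;
  R_max : R;
  L_R : R;
  Kpr : nat;
  Kpr_gt0 : (0 < Kpr)%N;
  gam : S -> 'cV[R]_Kpr;
  ref : nat -> probability S R;
  Lambda_pr : R;
  L_gam : R;
  Kdu : nat;
  Kdu_gt0 : (0 < Kdu)%N;
  psi : E -> 'cV[R]_Kdu;
  Lambda_E : R;
  rho_psi : R;
  N : nat;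
  N_gt0 : (0 < N)%N;
  M : nat;
  M_gt0 : (0 < M)%N;
  L : nat;
  L_gt0 : (0 < L)%N;
  gridS : L.-tuple S;
  gridS_uniq : uniq gridS;
  gridA : L.-tuple A;
  gridA_uniq : uniq gridA }.
Arguments setup : clear implicits.
Arguments setup R {dS dA dE} S A E.

Section algorithm.
Context {R : realType} {dS dA dE} {S : measurableType dS}
  {A : measurableType dA} {E : measurableType dE}.
Variables (m : mdp R S A) (u : setup R S A E).
Let H := horizon m.

Definition rho (z z' : S * A) : R :=
  norm2 u (distS u z.1 z'.1) (distA u z.2 z'.2).

Definition Sigma_pr (h : nat) : 'M[R]_(Kpr u) :=
  \matrix_(i, j) \int[ref u h]_x (gam u x i 0 * gam u x j 0).

Definition Sigma_E : 'M[R]_(Kdu u) :=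
  \matrix_(i, j) \int[noise u]_e (psi u e i 0 * psi u e j 0).

Definition assumption_B1 : Prop :=
  [/\ forall h, (0 < h <= H)%N ->
        measurable_fun setT (fun z : S * A * E => next u h z.1.1 z.1.2 z.2),
      forall h x a B, (0 < h <= H)%N -> measurable B ->
        trans m h (x, a) B = noise u (next u h x a @^-1` B),
      [/\ is_metric (distS u), is_metric (distA u), is_norm2 (norm2 u)
        & is_metric rho] &
      forall h x a x' a' e, (0 < h <= H)%N ->
        distS u (next u h x a e) (next u h x' a' e)
          <= L_K u * rho (x, a) (x', a')].

Definition assumption_B2 : Prop :=
  [/\ forall h x a, (h < H)%N -> `|reward m h x a| <= R_max u,
      forall x, `|terminal m x| <= R_max u &
      forall h x x' a, (h < H)%N ->
        `|reward m h x a - reward m h x' a| <= L_R u * distS u x x'].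

Definition assumption_B3 : Prop :=
  [/\ forall k, measurable_fun setT (fun x => gam u x k 0),
      forall h x a, (0 < h <= H)%N -> trans m h (x, a) `<< ref u h,
      forall h, (h < H)%N -> Sigma_pr h \in unitmx,
      forall h x, (h < H)%N ->
        `|invmx (Sigma_pr h) *m gam u x| <= Lambda_pr u :> R &
      0 < L_gam u /\
      forall x x', enorm (gam u x - gam u x') <= L_gam u * distS u x x'].

Definition assumption_B4 : Prop :=
  [/\ forall k, (fun e => psi u e k 0) \in Lfun (noise u) 2%:E,
      forall k, \int[noise u]_e psi u e k 0 = 0,
      Sigma_E \in unitmx,
      forall e, `|invmx Sigma_E *m psi u e| <= Lambda_E u :> R &
      (\int[noise u]_e (enorm (psi u e) ^+ 2)%:E <= (rho_psi u ^+ 2)%:E)%E].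

Definition truncate (l : R) (g : S -> R) (x : S) : R :=
  Num.max (- l) (Num.min l (g x)).

Definition L_tilde (h : nat) : R := (H - h).+1%:R * R_max u.
Definition V_max : R := H.+1%:R * R_max u.
Definition L_V : R :=
  L_R u + V_max * Lambda_pr u * L_gam u * Num.sqrt (Kpr u)%:R.

Definition beta (h : nat) (D : (N u).-tuple (S * E)) (V : S -> R) (a : A) :
    'cV[R]_(Kpr u) :=
  (N u)%:R^-1 *: \sum_(i < N u)
    V (next u h.+1 (tnth D i).1 a (tnth D i).2)
      *: (invmx (Sigma_pr h) *m gam u (tnth D i).1).

(* V_{h,N} computed from the data of the steps h, ..., H-1. *)
Fixpoint primal (h : nat) (s : seq ((N u).-tuple (S * E))) : S -> R :=
  if s is D :: s' then
    fun x => sup [set reward m h x a +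
        truncate (L_tilde h.+1)
          (fun z => ((beta h D (primal h.+1 s') a)^T *m gam u z) 0 0) x
      | a in [set: A]]
  else terminal m.

Definition primal_data := H.-tuple ((N u).-tuple (S * E)).
Definition dual_data := H.-tuple ((M u).-tuple E).

Definition V_N (h : nat) (D : primal_data) : S -> R := primal h (drop h D).

(* The vector of the c_{k,M}, for the dual samples of step t + 1. *)
Definition c_M (t : 'I_H) (D : primal_data) (D' : dual_data) (z : S * A) :
    'cV[R]_(Kdu u) :=
  (M u)%:R^-1 *: \sum_(i < M u)
    V_N t.+1 D (next u t.+1 z.1 z.2 (tnth (tnth D' t) i))
      *: (invmx Sigma_E *m psi u (tnth (tnth D' t) i)).

Definition grid : set (S * A) :=
  [set z | z.1 \in tval (gridS u) /\ z.2 \in tval (gridA u)].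

(* sup and inf range over a finite nonempty set: they are max and min. *)
Definition H_low (l : R) (f : S * A -> R) (z : S * A) : R :=
  sup [set f z' - l * rho z z' | z' in grid].
Definition H_up (l : R) (f : S * A -> R) (z : S * A) : R :=
  inf [set f z' + l * rho z z' | z' in grid].
Definition interpolate (l : R) (f : S * A -> R) (z : S * A) : R :=
  (H_low l f z + H_up l f z) / 2.

Definition c_tilde (t : 'I_H) (D : primal_data) (D' : dual_data)
    (k : 'I_(Kdu u)) : S * A -> R :=
  interpolate (L_V * L_K u * Lambda_E u) (fun z => c_M t D D' z k 0).

(* eta_tilde t and eta_star t are the functions of index t + 1; the argument e
   is the innovation of index t + 1. *)
Definition eta_tilde (t : 'I_H) (w : primal_data * dual_data) (z : S * A)
    (e : E) : R :=
  \sum_(k < Kdu u) c_tilde t w.1 w.2 k z * psi u e k 0.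

Definition eta_star (t : 'I_H) (z : S * A) (e : E) : R :=
  Vstar m t.+1 (next u t.+1 z.1 z.2 e)
  - \int[noise u]_e' Vstar m t.+1 (next u t.+1 z.1 z.2 e').

Definition noise_path := H.-tuple E.
Definition actions := H.-tuple A.

(* tnth e t is the innovation of index t + 1. *)
Fixpoint chain (h : nat) (x : S) (s : seq (A * E)) : S :=
  if s is (a, e) :: s' then chain h.+1 (next u h.+1 x a e) s' else x.

Definition state (x : S) (a : actions) (e : noise_path) (t : nat) : S :=
  chain 0 x (take t (zip a e)).

Definition pathwise (x : S) (a : actions) (w : primal_data * dual_data)
    (e : noise_path) : R :=
  \sum_(t < H)
    (reward m t (state x a e t) (tnth a t)
     - eta_tilde t w (state x a e t, tnth a t) (tnth e t))
  + terminal m (state x a e H).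

Definition presim_law : probability (primal_data * dual_data)%type R :=
  (prodP (fun h : 'I_H => iidP (N u) (ref u h \x noise u))
   \x iidP H (iidP (M u) (noise u)))%E.

Definition noise_law : probability noise_path R := iidP H (noise u).

Definition overall_law :
    probability ((primal_data * dual_data) * noise_path)%type R :=
  (presim_law \x noise_law)%E.

Definition V_up (x : S) : \bar R :=
  (\int[overall_law]_w
     esssup overall_law (fun a w => (pathwise x a w.1 w.2)%:E) w)%E.

Definition test_law (n : nat) :
    probability ((primal_data * dual_data) * n.-tuple noise_path)%type R :=
  (presim_law \x iidP n noise_law)%E.

Definition V_up_test (n : nat) (x : S)
    (w : (primal_data * dual_data) * n.-tuple noise_path) : \bar R :=
  ((n%:R^-1)%:E * \sum_(i < n)
     esssup (test_law n) (fun a w => (pathwise x a w.1 (tnth w.2 i))%:E) w)%E.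

(* E_x[sup_(y,a) |eta*_(t+1)(y,a) - eta~_(t+1)(y,a)|^2]^(1/2) *)
Definition eta_error (t : 'I_H) : \bar R :=
  ((\int[overall_law]_w
      esssup overall_law
        (fun z w => (`|eta_star t z (tnth w.2 t)
                       - eta_tilde t w.1 z (tnth w.2 t)| ^+ 2)%:E) w)
   `^ 2^-1)%E.

End algorithm.

Arguments V_up_test {R dS dA dE S A E} m u n x w.
Arguments eta_error {R dS dA dE S A E} m u t.

(* Main.v *)
Require Import Defs.
From mathcomp Require Import all_boot all_order all_algebra.
From mathcomp Require Import all_classical all_reals all_analysis.
From mathcomp Require Import measurable_realfun.
From mathcomp Require Import ring.

Set Implicit Arguments.
Unset Strict Implicit.
Unset Printing Implicit Defensive.

Import Order.TTheory GRing.Theory Num.Theory.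
Import numFieldNormedType.Exports.

Local Open Scope classical_set_scope.
Local Open Scope ring_scope.
Local Open Scope ereal_scope.

(** For every realization of the noise and every action sequence, the dual
objective built with the optimal martingale functions telescopes, by the Bellman
equation, to [Vstar 0 x] minus a sum of nonnegative Bellman gaps; picking
near-optimal actions along the path makes these gaps arbitrarily small. Hence
its supremum over actions equals [Vstar 0 x] pathwise, and replacing the optimal
martingale functions by the estimated ones moves this supremum by at most the
sum over [t] of the suprema of their differences. Both bounds follow from the
triangle inequality in L^2, averaging over the test paths being a convex
combination; the second one thus holds with constant 1. *)

(** * Measurable hulls and existence of essential suprema of families *)

(** Intersecting measurable supersets whose measures tend to the infimum yields a set attaining it;
    cutting that set by another measurable superset [B] cannot lower the measure, so the part
    outside [B] is null. *)
Lemma measurable_hull (d : measure_display) (T : measurableType d)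
    (R : realType) (P : {finite_measure set T -> \bar R}) (C : set T) :
  exists A, [/\ measurable A, C `<=` A &
    forall B, measurable B -> C `<=` B -> P (A `\` B) = 0].
Proof.
pose X := [set P B | B in [set B | measurable B /\ C `<=` B]].
have PT (B : set T) : measurable B -> P B < +oo.
  by move=> mB; rewrite ltey_eq fin_num_measure.
have X0 : 0 <= ereal_inf X by apply: le_ereal_inf_tmp => _ [B _ <-].
have Xfin : ereal_inf X \is a fin_num.
  rewrite ge0_fin_numE//; apply: le_lt_trans (PT _ (@measurableT _ T)).
  by apply: ereal_inf_lbound; exists setT.
have /choice[B hB] (n : nat) : exists B, [/\ measurable B, C `<=` B &
    P B < ereal_inf X + n.+1%:R^-1%:E].
  have e0 : (0 < n.+1%:R^-1 :> R)%R by rewrite invr_gt0.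
  by have [_ [B [mB CB] <-] ltB] := lb_ereal_inf_adherent e0 Xfin; exists B.
have mA : measurable (\bigcap_n B n).
  by apply: bigcap_measurableType => n _; case: (hB n).
exists (\bigcap_n B n); split=> //.
  by move=> w Cw n _; case: (hB n) => _ + _; apply.
move=> B' mB' CB'; apply/eqP; rewrite eq_le measure_ge0 andbT.
rewrite measureD// ?PT// leeBlDr ?fin_num_measure//; last exact: measurableI.
rewrite add0e; apply: (@le_trans _ _ (ereal_inf X)); last first.
  apply: ereal_inf_lbound; exists (\bigcap_n B n `&` B') => //; split.
    exact: measurableI.
  by move=> w Cw; split; [move=> n _; case: (hB n) => _ + _; apply|exact: CB'].
apply/lee_addgt0Pr => e e0.
have [n ne] : exists n : nat, (n.+1%:R^-1 < e)%R.
  have := near_infty_natSinv_lt (PosNum e0).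
  by case=> n _ /(_ n (leqnn n)) /= ?; exists n.
case: (hB n) => mBn CBn ltn; apply: (@le_trans _ _ (P (B n))).
  by rewrite le_measure ?inE//; exact: bigcap_inf.
by rewrite (le_trans (ltW ltn))// leeD2l// lee_fin ltW.
Qed.

Lemma lt_ereal_ratr (R : realType) (x y : \bar R) :
  x < y -> exists q : rat, x < (ratr q)%:E < y.
Proof.
have rat r s : (r < s)%R ->
    exists q : rat, (r%:E : \bar R) < (ratr q)%:E < s%:E.
  by move=> /rat_in_itvoo[q]; rewrite in_itv /= => ?; exists q; rewrite !lte_fin.
case: x y => [r| |] [s| |] //=; rewrite ?lte_fin.
- exact: rat.
- move=> _; have [|q /andP[rq _]] := rat r (r + 1)%R; first by rewrite ltrDl.
  by exists q; rewrite rq ltry.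
- move=> _; have [|q /andP[_ qs]] := rat (s - 1)%R s.
    by rewrite ltrBlDr ltrDl.
  by exists q; rewrite qs ltNyr.
- by move=> _; exists 0%R; rewrite ltNyr ltry.
Qed.

(* The essential supremum glues measurable hulls of the superlevel sets of the
   pointwise supremum at rational levels. *)
Lemma is_esssup_exists (d : measure_display) (T : measurableType d)
    (R : realType) (P : {finite_measure set T -> \bar R}) (I : Type)
    (f : I -> T -> \bar R) : exists g, is_esssup P f g.
Proof.
have /choice[C hC] (q : rat) :=
  measurable_hull P [set w | exists i, (ratr q)%:E < f i w].
(* The rationals are enumerated through [unpickle]; [-oo], neutral for suprema, fills the indices
   that code no rational and the points outside [C q]. *)
pose h n w : \bar R := if unpickle n is Some q then
  if w \in C q then (ratr q)%:E else -oo else -oo.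
have mh n : measurable_fun setT (h n).
  rewrite /h; case: (unpickle n) => [q|]//; apply: measurable_fun_ifT => //.
  apply: (measurable_fun_bool true); rewrite setTI.
  rewrite (_ : _ @^-1` _ = C q); first by case: (hC q).
  by apply/seteqP; split=> w /= => [/set_mem|/mem_set].
pose g w := esups (h ^~ w) 0%N.
have geP w y : (forall q, C q w -> (ratr q)%:E <= y) -> g w <= y.
  move=> hy; apply: ge_ereal_sup => _ [n _ <-]; rewrite /h.
  case: (unpickle n) => [q|]; last exact: leNye.
  by case: ifPn => [/set_mem/hy//|_]; exact: leNye.
have leg w q : C q w -> (ratr q)%:E <= g w.
  move=> Cw; apply: ereal_sup_ubound; exists (pickle q) => //.
  by rewrite /h pickleK mem_set.
exists g; split.
- exact: (measurable_fun_esups mh).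
- apply: aeW => w i; rewrite leNgt; apply/negP.
  move=> /lt_ereal_ratr[q /andP[gq qf]].
  have Cw : C q w by case: (hC q) => _ + _; apply; exists i.
  by have := leg _ _ Cw; rewrite leNgt gq.
- move=> g' mg' [X [mX X0 subX]].
  (* Outside the null set [X], [g'] dominates the family; adjoining [X] makes [B q] contain the
     whole superlevel set, so the hull property applies. *)
  pose B q := [set w | (ratr q)%:E <= g' w] `|` X.
  have mB q : measurable (B q).
    apply: measurableU => //; rewrite -[X in measurable X]setTI.
    exact: emeasurable_fun_c_infty.
  have CB q : P (C q `\` B q) = 0.
    have [_ _ hull] := hC q; apply: hull => // w [i qf].
    have [Xw|nXw] := pselect (X w); [by right|left => /=].
    have := subsetC subX; rewrite setCK => /(_ _ nXw) /(_ i).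
    exact/le_trans/ltW.
  (* As the rationals are countable, a single null set suffices outside which [C q] lies in [B q]
     for every [q]. *)
  have : \forall w \ae P, forall n q, unpickle n = Some q ->
      ~ (C q `\` B q) w.
    apply/ae_foralln => n; case: (unpickle n) => [q|]; last exact: aeW.
    exists (C q `\` B q); split => //.
    + by apply: measurableD => //; case: (hC q).
    + exact: CB.
    + by move=> w /= hw; apply: contrapT => nw; apply: hw => _ [<-].
  have : \forall w \ae P, ~ X w by exists X; split=> // w /= /contrapT.
  apply: filterS2 => w nX hw; apply: geP => q Cqw.
  have nCB := hw _ _ (pickleK q); apply: contrapT => ngq; apply: nCB.
  by split=> // -[].
Qed.

(** Existence rules out the fallback branch of [esssup], so its defining properties hold for
    arbitrary families on a finite measure space. *)
Lemma esssupP (d : measure_display) (T : measurableType d) (R : realType)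
    (P : {finite_measure set T -> \bar R}) (I : Type) (f : I -> T -> \bar R) :
  is_esssup P f (esssup P f).
Proof.
rewrite /esssup; case: xgetP => [? -> //|].
by have [g ?] := is_esssup_exists P f => /(_ g).
Qed.

(** * L^2 norms and their transport along measure-preserving maps *)

Lemma Lnorm2E (d : measure_display) (T : measurableType d) (R : realType)
    (P : {measure set T -> \bar R}) (f : T -> R) :
  'N[P]_2%:E[EFin \o f] = (\int[P]_w (f w ^+ 2)%:E) `^ 2^-1.
Proof.
rewrite unlock; congr (_ `^ _); apply: eq_integral => w _ /=.
by rewrite powR_mulrn// real_normK// num_real.
Qed.

Lemma le_Lnorm2 (d : measure_display) (T : measurableType d) (R : realType)
    (P : {measure set T -> \bar R}) (f g : T -> R) :
  measurable_fun setT f -> measurable_fun setT g ->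
  (forall w, `|f w| <= `|g w|)%R ->
  'N[P]_2%:E[EFin \o f] <= 'N[P]_2%:E[EFin \o g].
Proof.
move=> mf mg fg; rewrite !Lnorm2E gt0_ler_poweR ?invr_ge0//.
- by rewrite in_itv /= leey integral_ge0// => w _; rewrite lee_fin sqr_ge0.
- by rewrite in_itv /= leey integral_ge0// => w _; rewrite lee_fin sqr_ge0.
apply: ge0_le_integral => //.
- by move=> w _; rewrite lee_fin sqr_ge0.
- exact/measurable_EFinP/measurable_funX.
- exact/measurable_EFinP/measurable_funX.
- move=> w _; rewrite lee_fin -[leLHS]real_normK ?num_real//.
  by rewrite -[leRHS]real_normK ?num_real// ler_pXn2r ?nnegrE.
Qed.

Lemma Lnorm2Z (d : measure_display) (T : measurableType d) (R : realType)
    (P : {measure set T -> \bar R}) (c : R) (f : T -> R) : (0 <= c)%R ->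
  measurable_fun setT f ->
  'N[P]_2%:E[EFin \o (fun w => c * f w)%R] = c%:E * 'N[P]_2%:E[EFin \o f].
Proof.
move=> c0 mf; rewrite !Lnorm2E.
under eq_integral do rewrite exprMn EFinM.
rewrite ge0_integralZl_EFin ?sqr_ge0//; last first.
- exact/measurable_EFinP/measurable_funX.
- by move=> w _; rewrite lee_fin sqr_ge0.
rewrite poweRM ?lee_fin ?sqr_ge0//; last first.
  by apply: integral_ge0 => w _; rewrite lee_fin sqr_ge0.
by rewrite poweR_EFin powR12_sqrt ?sqr_ge0// sqrtr_sqr ger0_norm.
Qed.

Lemma Lnorm2_sum (d : measure_display) (T : measurableType d) (R : realType)
    (P : {measure set T -> \bar R}) (n : nat) (f : 'I_n -> T -> R) :
  (forall i, measurable_fun setT (f i)) ->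
  'N[P]_2%:E[EFin \o (fun w => \sum_(i < n) f i w)%R]
    <= \sum_(i < n) 'N[P]_2%:E[EFin \o f i].
Proof.
elim: n f => [|n IH] f mf.
  rewrite big_ord0 Lnorm2E; under eq_integral do rewrite big_ord0 expr0n/=.
  by rewrite integral0 poweR0r ?invr_eq0.
rewrite big_ord_recr /=.
rewrite (_ : (fun w => _) =
  ((fun w => \sum_(i < n) f (widen_ord (leqnSn n) i) w) \+ f ord_max)%R).
  apply: le_trans (minkowski_EFin P _ _ _) _ => //.
  - by apply: measurable_sum => i; exact: mf.
  - by rewrite ler1n.
  - by rewrite leeD2r// IH.
by apply/funext => w /=; rewrite big_ord_recr.
Qed.

(** Hölder's inequality against the constant [1], whose L^2 norm is [1] under a probability. *)
Lemma Lnorm1_le_Lnorm2 (d : measure_display) (T : measurableType d)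
    (R : realType) (P : probability T R) (f : T -> R) :
  measurable_fun setT f -> 'N[P]_1[EFin \o f] <= 'N[P]_2%:E[EFin \o f].
Proof.
move=> mf; have := @hoelder _ _ _ P f (cst 1%R) 2 2 mf.
rewrite (_ : f \* cst 1 = f)%R; last by apply/funext => w /=; rewrite mulr1.
have half : (2^-1 + 2^-1 = 1 :> R)%R by rewrite [RHS](splitr 1) !div1r.
move=> /(_ (measurable_cst _) (ltr0Sn _ _) (ltr0Sn _ _) half) /le_trans; apply.
rewrite (_ : EFin \o cst 1%R = cst 1)//.
by rewrite Lnorm_cst1 [X in X `^ _]probability_setT poweR1r mule1.
Qed.

Lemma Lnorm2_comp (d d' : measure_display) (T : measurableType d)
    (T' : measurableType d') (R : realType) (P : {measure set T -> \bar R})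
    (P' : {measure set T' -> \bar R}) (phi : T' -> T) (f : T -> R) :
  measurable_fun setT phi ->
  (forall B, measurable B -> P' (phi @^-1` B) = P B) ->
  measurable_fun setT f ->
  'N[P']_2%:E[EFin \o (f \o phi)] = 'N[P]_2%:E[EFin \o f].
Proof.
move=> mphi phiP mf; rewrite !Lnorm2E; congr (_ `^ _).
rewrite -(@eq_measure_integral _ _ _ _ P (pushforward P' phi)) /=; last first.
  by move=> B mB _; rewrite -phiP.
rewrite (ge0_integral_pushforward mphi)//.
- exact/measurable_EFinP/measurable_funX.
- by move=> w _; rewrite lee_fin sqr_ge0.
Qed.

Lemma ae_comp (d d' : measure_display) (T : measurableType d)
    (T' : measurableType d') (R : realType) (P : {measure set T -> \bar R})
    (P' : {measure set T' -> \bar R}) (phi : T' -> T) (Q : T -> Prop) :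
  measurable_fun setT phi ->
  (forall B, measurable B -> P' (phi @^-1` B) = P B) ->
  {ae P, forall w, Q w} -> {ae P', forall w, Q (phi w)}.
Proof.
move=> mphi phiP [B [mB B0 QB]]; exists (phi @^-1` B); split.
- by rewrite -[X in measurable X]setTI; exact: mphi.
- by rewrite phiP.
- by move=> w /= nQ; exact: QB.
Qed.

(** * From essential suprema to real random variables *)

(** Turns an extended-valued bound on squares, such as the essential supremum in [eta_error], into a
    real random variable to which Minkowski's inequality applies. The finite integral makes [G]
    finite almost everywhere, and dominating the square at [i0] makes it nonnegative there. *)
Lemma sqrt_majorant (d : measure_display) (T : measurableType d) (R : realType)
    (P : {measure set T -> \bar R}) (I : Type) (i0 : I) (f : I -> T -> R)
    (G : T -> \bar R) : measurable_fun setT G ->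
  {ae P, forall w, forall i, (`|f i w| ^+ 2)%:E <= G w} ->
  \int[P]_w G w < +oo ->
  exists s : T -> R, [/\ measurable_fun setT s, forall w, (0 <= s w)%R,
    {ae P, forall w, forall i, (`|f i w| <= s w)%R} &
    'N[P]_2%:E[EFin \o s] = (\int[P]_w G w) `^ 2^-1].
Proof.
move=> mG fG intG.
pose G0 w := maxe (G w) 0.
have mG0 : measurable_fun setT G0 by exact: measurable_maxe.
have G0_ge0 w : 0 <= G0 w by rewrite /G0 le_max lexx orbT.
have GG0 : ae_eq P setT G G0.
  apply: filterS fG => w /(_ i0) fG _; rewrite /G0 max_l//.
  by apply: le_trans fG; rewrite lee_fin sqr_ge0.
have intE : \int[P]_w G w = \int[P]_w G0 w by exact: ae_eq_integral.
have G0fin : {ae P, forall w, G0 w \is a fin_num}.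
  have : P.-integrable setT G0.
    apply/integrableP; split=> //.
    by under eq_integral do rewrite gee0_abs//; rewrite -intE.
  by move=> /(integrable_ae measurableT); apply: filterS => w; exact.
have G0E : ae_eq P setT (fun w => (Num.sqrt (fine (G0 w)) ^+ 2)%:E) G0.
  apply: filterS G0fin => w fin _.
  by rewrite sqr_sqrtr ?fine_ge0// fineK.
have ms : measurable_fun setT (fun w => Num.sqrt (fine (G0 w))).
  have msqrt := continuous_measurable_fun (@sqrt_continuous R).
  have mfine : measurable_fun setT (fun w => fine (G0 w)).
    exact: measurableT_comp.
  exact: measurableT_comp msqrt mfine.
exists (fun w => Num.sqrt (fine (G0 w))); split=> //.
- apply: filterS3 fG G0fin GG0 => w fG fin /(_ Logic.I) GG0 i.
  rewrite -[leLHS]ger0_norm// -sqrtr_sqr ler_wsqrtr//.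
  by rewrite -lee_fin fineK// -GG0.
- rewrite Lnorm2E intE; congr (_ `^ _); apply: ae_eq_integral => //.
  exact/measurable_EFinP/measurable_funX.
Qed.

(* Clipping the essential supremum to the band of radius h around v makes it
   real-valued without changing it outside a null set. *)
Lemma esssup_band (d : measure_display) (T : measurableType d) (R : realType)
    (P : {finite_measure set T -> \bar R}) (I : Type) (f : I -> T -> R)
    (v : R) (h : T -> R) :
  measurable_fun setT h -> (forall w, 0 <= h w)%R ->
  {ae P, forall w, (forall i, f i w <= v + h w)%R /\
    forall y, (forall i, (f i w)%:E <= y) -> (v - h w)%:E <= y} ->
  exists D : T -> R, [/\ measurable_fun setT D,
    forall w, (`|D w| <= h w)%R &
    {ae P, forall w, esssup P (fun i w => (f i w)%:E) w = (v + D w)%:E}].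
Proof.
move=> mh h0 band; have [mg fg gmin] := esssupP P (fun i w => (f i w)%:E).
set g := esssup _ _ in mg fg gmin *.
(* The upper side comes from minimality against the measurable majorant [v + h]; the lower side
   holds wherever [g] dominates the whole family. *)
have gU : {ae P, forall w, g w <= (v + h w)%:E}.
  apply: gmin; first exact/measurable_EFinP/measurable_funD.
  by apply: filterS band => w [+ _] i => /(_ i); rewrite lee_fin.
exists (fun w => Num.max (- h w) (Num.min (h w) (fine (g w) - v)))%R; split.
- apply: measurable_maxr; first exact: measurableT_comp.
  apply: measurable_minr => //; apply: measurable_funB => //.
  exact: measurableT_comp.
- move=> w; rewrite ler_norml le_max lexx /= ge_max ge_min lexx andbT.
  by rewrite lerNl (le_trans _ (h0 w))// oppr_le0.
- apply: filterS3 band fg gU => w [_ gL] /gL {}gL.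
  case: (g w) gL => [r| |]//=; rewrite !lee_fin => gL gU.
  by rewrite min_r ?max_r ?subrKC// ?lerBlDl// lerBrDl.
Qed.

(** * Boundedness of the optimal values and the Bellman equation *)

Lemma measurable_next (R : realType) (dS dA dE : measure_display)
    (S : measurableType dS) (A : measurableType dA) (E : measurableType dE)
    (m : mdp R S A) (u : setup R S A E) (h : nat) (y : S) (a : A) :
  assumption_B1 m u -> (0 < h <= horizon m)%N ->
  measurable_fun setT (Defs.next u h y a).
Proof.
move=> [mnext _ _ _] hH.
rewrite (_ : Defs.next u h y a =
  (fun z : S * A * E => Defs.next u h z.1.1 z.1.2 z.2) \o (fun e => ((y, a), e)))//.
exact: measurableT_comp (mnext h hH) (measurable_fun_pair _ _).
Qed.

(** The kernel is the image of the noise law under [next], so the first claim is a change of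
    variables; the bound survives because the kernel has mass one, and feeds the backward induction
    on [Vstar]. *)
Lemma P_op_next (R : realType) (dS dA dE : measure_display)
    (S : measurableType dS) (A : measurableType dA) (E : measurableType dE)
    (m : mdp R S A) (u : setup R S A E) (h : nat) (V : S -> R) (y : S) (a : A)
    (C : R) :
  assumption_B1 m u -> (0 < h <= horizon m)%N ->
  measurable_fun setT V -> (forall z, `|V z| <= C)%R ->
  P_op m h V y a = (\int[noise u]_e V (Defs.next u h y a e))%R /\
  (`|P_op m h V y a| <= C)%R.
Proof.
move=> B1 hH mV VC; have mnext := measurable_next y a B1 hH.
have [_ transE _ _] := B1.
have bint (d : measure_display) (T : measurableType d)
    (Q : {measure set T -> \bar R}) (g : T -> R) : Q setT = 1 ->
    measurable_fun setT g -> (forall t, `|g t| <= C)%R ->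
    Q.-integrable setT (EFin \o g).
  move=> Q1 mg gC; apply: measurable_bounded_integrable => //.
    by rewrite Q1 ltry.
  exists C; split; first exact: num_real.
  by move=> M CM t _; exact: le_trans (gC t) (ltW CM).
split.
  rewrite /P_op /Rintegral; congr fine.
  rewrite (@eq_measure_integral _ _ _ _
    (pushforward (noise u) (Defs.next u h y a)))/=.
    rewrite (integral_pushforward mnext (f := EFin \o V))//.
      exact/measurable_EFinP.
    apply: bint; [exact: probability_setT|exact: measurableT_comp mV mnext|].
    by move=> e; exact: VC.
  by move=> B mB _; exact: transE.
have trans1 : trans m h (y, a) setT = 1 by exact: prob_kernel.
have iV := bint _ _ _ _ trans1 mV VC.
rewrite /P_op; apply: le_trans (le_normr_Rintegral _ iV) _ => //.
apply: (@le_trans _ _ (\int[trans m h (y, a)]_z C)%R).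
  apply: le_Rintegral => //.
  - apply: (bint _ _ _ (fun z => `|V z|)%R) => //; first exact: measurableT_comp.
    by move=> z; rewrite normr_id.
  - apply: (bint _ _ _ (fun=> C)) => // z; rewrite ger0_norm//.
    exact: le_trans (normr_ge0 _) (VC z).
by rewrite Rintegral_cst// trans1 mulr1.
Qed.

(** The action [a0] provides a constant policy; with no policy at all the supremum would range over
    the empty set. *)
Lemma Vstar_horizon (R : realType) (dS dA : measure_display)
    (S : measurableType dS) (A : measurableType dA) (m : mdp R S A) (a0 : A) :
  Vstar m (horizon m) = terminal m.
Proof.
apply/funext => y; rewrite /Vstar.
rewrite [X in sup X](_ : _ = [set terminal m y]) ?sup1//.
apply/seteqP; split => [_ [pi _ <-]|_ ->].
  by rewrite /policy_value subnn /= add0r.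
exists (fun _ => kdirac (measurable_cst a0)) => //.
by rewrite /policy_value subnn /= add0r.
Qed.

(** A real [sup] is meaningful only for nonempty sets bounded above. Backward induction through the
    Bellman equation adds one reward bound per remaining step. *)
Lemma Vstar_bounded (R : realType) (dS dA dE : measure_display)
    (S : measurableType dS) (A : measurableType dA) (E : measurableType dE)
    (m : mdp R S A) (u : setup R S A E) (a0 : A) (h : nat) :
  dynamic_programming m -> assumption_B1 m u -> assumption_B2 m u ->
  (h <= horizon m)%N -> exists C : R, forall y, (`|Vstar m h y| <= C)%R.
Proof.
move=> [mV Bell] B1 [Rmax Fmax _].
move: {-1}(horizon m - h)%N (erefl (horizon m - h)%N) => k.
elim: k h => [|k IH] h hk hH.
  have -> : h = horizon m by apply/eqP; rewrite eqn_leq hH /leq hk.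
  by exists (R_max u) => y; rewrite Vstar_horizon.
have hlt : (h < horizon m)%N by rewrite -subn_gt0 hk.
have [|C hC] := IH h.+1 _ hlt; first by rewrite subnS hk.
exists (R_max u + C)%R => y; rewrite Bell//.
set X := [set _ | _ in _].
have XC r : X r -> (`|r| <= R_max u + C)%R.
  move=> [a _ <-]; apply: le_trans (ler_normD _ _) _; apply: lerD.
    exact: Rmax.
  by have [_] := P_op_next (h := h.+1) y a B1 hlt (mV _ hlt) hC.
have Xa0 : X (reward m h y a0 + P_op m h.+1 (Vstar m h.+1) y a0)%R by exists a0.
have Xub : ubound X (R_max u + C)%R.
  by move=> r /XC; exact/le_trans/ler_norm.
rewrite ler_norml; apply/andP; split.
  apply: (@le_trans _ _ (reward m h y a0 + P_op m h.+1 (Vstar m h.+1) y a0)%R).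
    by have := XC _ Xa0; rewrite ler_norml => /andP[].
  by apply: ub_le_sup => //; exists (R_max u + C)%R.
by apply: ge_sup => //; eexists; exact: Xa0.
Qed.

(** The optimal action-value function, integrated over the innovation rather than the kernel so that
    the integral cancels literally against the one in [eta_star]. *)
Definition Qstar (R : realType) (dS dA dE : measure_display)
    (S : measurableType dS) (A : measurableType dA) (E : measurableType dE)
    (m : mdp R S A) (u : setup R S A E) (t : nat) (y : S) (a : A) : R :=
  (reward m t y a + \int[noise u]_e Vstar m t.+1 (Defs.next u t.+1 y a e))%R.

(** The two halves of the Bellman equation serve separately: the first bounds the dual objective
    from above, the second supplies near-optimal actions. *)
Lemma Bellman (R : realType) (dS dA dE : measure_display)
    (S : measurableType dS) (A : measurableType dA) (E : measurableType dE)
    (m : mdp R S A) (u : setup R S A E) (a0 : A) (t : nat) (y : S) :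
  dynamic_programming m -> assumption_B1 m u -> assumption_B2 m u ->
  (t < horizon m)%N ->
  (forall a, (Qstar m u t y a <= Vstar m t y)%R) /\
  (forall e, (0 < e)%R -> exists a, (Vstar m t y - e < Qstar m u t y a)%R).
Proof.
move=> DP B1 B2 tH; have [mV Bell] := DP; have [Rmax _ _] := B2.
have [C hC] := Vstar_bounded a0 DP B1 B2 tH.
rewrite Bell//; set X := [set _ | _ in _].
have QE a : Qstar m u t y a =
    (reward m t y a + P_op m t.+1 (Vstar m t.+1) y a)%R.
  by rewrite /Qstar; have [->] := P_op_next (h := t.+1) y a B1 tH (mV _ tH) hC.
have Xsup : has_sup X.
  split.
    by exists (reward m t y a0 + P_op m t.+1 (Vstar m t.+1) y a0)%R, a0.
  exists (R_max u + C)%R => _ [a _ <-]; apply: lerD.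
    by apply: le_trans (ler_norm _) _; exact: Rmax.
  apply: le_trans (ler_norm _) _.
  by have [_] := P_op_next (h := t.+1) y a B1 tH (mV _ tH) hC.
split=> [a|e e0].
  by rewrite QE; apply: ub_le_sup; [exact: Xsup.2|exists a].
by have [_ [a _ <-]] := sup_adherent e0 Xsup; exists a; rewrite QE.
Qed.

(** * Trajectories, telescoping and the pathwise band *)

(** The recursion of [chain] peels off the first innovation, whereas one more time step appends a
    last one; this lemma reconciles the two ends. *)
Lemma chain_rcons (R : realType) (dS dA dE : measure_display)
    (S : measurableType dS) (A : measurableType dA) (E : measurableType dE)
    (u : setup R S A E) (h : nat) (y : S) (s : seq (A * E)) (z : A * E) :
  chain u h y (rcons s z) =
    Defs.next u (h + size s).+1 (chain u h y s) z.1 z.2.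
Proof.
elim: s h y => [|[a e] s IH] h y /=; first by case: z => a e; rewrite addn0.
by rewrite IH addSnnS.
Qed.

Lemma stateS (R : realType) (dS dA dE : measure_display)
    (S : measurableType dS) (A : measurableType dA) (E : measurableType dE)
    (m : mdp R S A) (u : setup R S A E) (x : S) (a : actions m)
    (e : (horizon m).-tuple E) (t : 'I_(horizon m)) :
  state u x a e t.+1 = Defs.next u t.+1 (state u x a e t) (tnth a t) (tnth e t).
Proof.
have sz : size (zip a e) = horizon m by rewrite size_zip !size_tuple minnn.
rewrite /state (take_nth (tnth a t, tnth e t)) ?sz//.
rewrite chain_rcons add0n size_take sz ltn_ord nth_zip ?size_tuple//=.
by rewrite -!tnth_nth.
Qed.

Lemma state0 (R : realType) (dS dA dE : measure_display)
    (S : measurableType dS) (A : measurableType dA) (E : measurableType dE)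
    (m : mdp R S A) (u : setup R S A E) (x : S) (a : actions m)
    (e : (horizon m).-tuple E) : state u x a e 0 = x.
Proof. by rewrite /state take0. Qed.

(* The optimal martingale functions telescope along every trajectory, for
   every realization of the noise. *)
Lemma pathwiseE (R : realType) (dS dA dE : measure_display)
    (S : measurableType dS) (A : measurableType dA) (E : measurableType dE)
    (m : mdp R S A) (u : setup R S A E) (x : S) (a : actions m)
    (w : primal_data m u * dual_data m u) (e : (horizon m).-tuple E) :
  pathwise x a w e = (Vstar m 0 x +
    \sum_(t < horizon m) (Qstar m u t (state u x a e t) (tnth a t)
                          - Vstar m t (state u x a e t)) +
    \sum_(t < horizon m)
      (eta_star u t (state u x a e t, tnth a t) (tnth e t)
       - eta_tilde t w (state u x a e t, tnth a t) (tnth e t)))%R.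
Proof.
have a0 := tnth a (Ordinal (horizon_gt0 m)).
rewrite /pathwise -(Vstar_horizon m a0).
pose W t := Vstar m t (state u x a e t).
rewrite -/(W (horizon m)) -[X in Vstar m 0 X](state0 u x a e) -/(W 0%N).
(* The terminal reward is [W 0] plus the increments of the optimal value along the trajectory, which
   reduces the claim to an algebraic identity at each time. *)
rewrite -[W (horizon m)](subrKC (W 0%N)).
rewrite -(telescope_sumr W (leq0n _)) big_mkord addrCA -addrA; congr (_ + _)%R.
rewrite -!big_split /=; apply: eq_bigr => t _.
rewrite /eta_star /Qstar /= /W stateS.
move: (\int[noise u]_e' _)%R (eta_tilde _ _ _ _) => I eta.
by ring.
Qed.

(* The supremum over actions is taken path by path, so near-optimal actions may
   be picked without any measurable selection. *)
Fixpoint greedy (R : realType) (dS dA dE : measure_display)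
    (S : measurableType dS) (A : measurableType dA) (E : measurableType dE)
    (u : setup R S A E) (pick : nat -> S -> A) (h : nat) (y : S)
    (s : seq E) : seq A :=
  if s is e :: s' then
    pick h y :: greedy u pick h.+1 (Defs.next u h.+1 y (pick h y) e) s'
  else [::].

Lemma size_greedy (R : realType) (dS dA dE : measure_display)
    (S : measurableType dS) (A : measurableType dA) (E : measurableType dE)
    (u : setup R S A E) (pick : nat -> S -> A) (h : nat) (y : S) (s : seq E) :
  size (greedy u pick h y s) = size s.
Proof. by elim: s h y => //= e s IH h y; rewrite IH. Qed.

(** The list built by [greedy] is a feedback control along its own trajectory: each choice is made
    at the state reached by the earlier ones. *)
Lemma nth_greedy (R : realType) (dS dA dE : measure_display)
    (S : measurableType dS) (A : measurableType dA) (E : measurableType dE)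
    (u : setup R S A E) (pick : nat -> S -> A) (a0 : A) (h : nat) (y : S)
    (s : seq E) (t : nat) : (t < size s)%N ->
  nth a0 (greedy u pick h y s) t =
    pick (h + t)%N (chain u h y (take t (zip (greedy u pick h y s) s))).
Proof.
elim: s h y t => // e s IH h y [|t] /=; first by rewrite addn0.
by rewrite ltnS => ts; rewrite IH// addSnnS.
Qed.

Lemma near_optimal_actions (R : realType) (dS dA dE : measure_display)
    (S : measurableType dS) (A : measurableType dA) (E : measurableType dE)
    (m : mdp R S A) (u : setup R S A E) (x : S) (e : (horizon m).-tuple E)
    (delta : R) :
  dynamic_programming m -> assumption_B1 m u -> assumption_B2 m u ->
  (0 < delta)%R ->
  exists a : actions m, forall t : 'I_(horizon m),
    (Vstar m t (state u x a e t) - delta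
      < Qstar m u t (state u x a e t) (tnth a t))%R.
Proof.
(* The action grid is nonempty; its first point serves wherever some element of [A] is required. *)
move=> DP B1 B2 delta0; have a0 := tnth (gridA u) (Ordinal (L_gt0 u)).
have /choice[pick pickP] (p : nat * S) : exists a, (p.1 < horizon m)%N ->
    (Vstar m p.1 p.2 - delta < Qstar m u p.1 p.2 a)%R.
  have [pH|] := ltnP p.1 (horizon m); last by exists a0.
  by have [_ /(_ _ delta0)[a ?]] := Bellman a0 p.2 DP B1 B2 pH; exists a.
have sz : size (greedy u (fun t y => pick (t, y)) 0 x e) == horizon m.
  by rewrite size_greedy size_tuple.
exists (Tuple sz) => t; rewrite [tnth (Tuple sz) t](tnth_nth a0)/=.
rewrite nth_greedy ?size_tuple// add0n.
exact: (pickP (nat_of_ord t, state u x (Tuple sz) e t) (ltn_ord t)).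
Qed.

(** Bellman gaps only lower the objective, and near-optimal actions make them negligible. The lower
    half is phrased through an arbitrary upper bound [y] because no action sequence need reach the
    bound. *)
Lemma pathwise_band (R : realType) (dS dA dE : measure_display)
    (S : measurableType dS) (A : measurableType dA) (E : measurableType dE)
    (m : mdp R S A) (u : setup R S A E) (x : S)
    (w : primal_data m u * dual_data m u) (e : (horizon m).-tuple E)
    (s : 'I_(horizon m) -> R) :
  dynamic_programming m -> assumption_B1 m u -> assumption_B2 m u ->
  (forall t z, `|eta_star u t z (tnth e t) - eta_tilde t w z (tnth e t)|
    <= s t)%R ->
  (forall a, pathwise x a w e <= Vstar m 0 x + \sum_t s t)%R /\
  forall y, (forall a, (pathwise x a w e)%:E <= y) ->
    (Vstar m 0 x - \sum_t s t)%:E <= y.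
Proof.
move=> DP B1 B2 etas; split=> [a|y hy].
  rewrite pathwiseE lerD//; last first.
    by apply: ler_sum => t _; exact: le_trans (ler_norm _) (etas _ _).
  rewrite gerDl; apply: sumr_le0 => t _; rewrite subr_le0.
  have [+ _] := Bellman (tnth a t) (state u x a e t) DP B1 B2 (ltn_ord t).
  exact.
apply/lee_addgt0Pr => d d0.
(* Each of the [horizon m] steps may lose this much, hence [d] in total. *)
have dH : (0 < d / (horizon m)%:R)%R by rewrite divr_gt0// ltr0n horizon_gt0.
have [a ha] := near_optimal_actions x e DP B1 B2 dH.
apply: (le_trans _ (leeD2r _ (hy a))); rewrite -EFinD lee_fin -lerBlDr.
rewrite pathwiseE addrAC; apply: lerD; last first.
  rewrite -sumrN; apply: ler_sum => t _.
  by have := etas t (state u x a e t, tnth a t); rewrite ler_norml => /andP[].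
rewrite lerD2l.
apply: (@le_trans _ _ (\sum_(t < horizon m) - (d / (horizon m)%:R))%R).
  rewrite sumrN sumr_const card_ord -[(_ *+ _)%R]mulr_natr divfK//.
  by rewrite pnatr_eq0 -lt0n horizon_gt0.
by apply: ler_sum => t _; rewrite lerBrDl ltW.
Qed.

(** * Joint law of the pre-simulations and one test path *)

(** A one-coordinate cylinder is a box whose other sides are the whole space, of mass one. *)
Lemma iidP_tnth (d : measure_display) (T : measurableType d) (R : realType)
    (n : nat) (P : probability T R) (i : 'I_n) (B : set T) : measurable B ->
  iidP n P ((fun w => tnth w i) @^-1` B) = P B.
Proof.
move=> mB; pose C j := if j == i then B else setT.
rewrite (_ : _ @^-1` B = [set w | forall j, C j (tnth w j)]); last first.
  apply/seteqP; split=> w /= Bw => [j|]; last by have := Bw i; rewrite /C eqxx.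
  by rewrite /C; case: eqP => // ->.
rewrite prodP_box => [|j]; last by rewrite /C; case: ifP.
rewrite (bigD1 i)//= /C eqxx big1 ?mule1// => j /negPf ->.
exact: probability_setT.
Qed.

(** All test paths share the pre-simulations, and each of them jointly with these follows the
    overall law. Agreement on measurable rectangles determines the product measure. *)
Lemma test_law_tnth (R : realType) (dS dA dE : measure_display)
    (S : measurableType dS) (A : measurableType dA) (E : measurableType dE)
    (m : mdp R S A) (u : setup R S A E) (n : nat) (i : 'I_n) :
  let phi := fun w : (primal_data m u * dual_data m u)
                     * n.-tuple ((horizon m).-tuple E) => (w.1, tnth w.2 i) in
  measurable_fun setT phi /\
  forall B, measurable B -> test_law m u n (phi @^-1` B) = overall_law m u B.
Proof.
move=> phi; have mphi : measurable_fun setT phi.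
  apply: measurable_fun_pair => //.
  by apply: measurableT_comp (measurable_tnth i) _; exact: measurable_snd.
split=> // B mB; apply/esym.
apply: (product_measure_unique (m' := pushforward (test_law m u n) phi)) => //.
move=> C D mC mD.
transitivity (test_law m u n (C `*` ((fun w => tnth w i) @^-1` D))) => //.
apply: etrans (product_measure1E _ _ mC _) _.
  by rewrite -[X in measurable X]setTI; exact: measurable_tnth.
by congr (_ * _); exact: iidP_tnth.
Qed.

(** * Deviation of the dual supremum from the optimal value in L^2 *)

Lemma integrable_Lnorm2_lty (d : measure_display) (T : measurableType d)
    (R : realType) (P : probability T R) (f : T -> R) :
  measurable_fun setT f -> 'N[P]_2%:E[EFin \o f] < +oo ->
  P.-integrable setT (EFin \o f).
Proof.
move=> mf f2; apply/integrableP; split; first exact/measurable_EFinP.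
by rewrite -[X in X < _]Lnorm1; apply: le_lt_trans f2; exact: Lnorm1_le_Lnorm2.
Qed.

(* V_up integrates over the overall law and V_up_test over a larger product
   space; the projection phi onto the overall law treats both at once. *)
Lemma dual_deviation (R : realType) (dS dA dE d : measure_display)
    (S : measurableType dS) (A : measurableType dA) (E : measurableType dE)
    (m : mdp R S A) (u : setup R S A E) (x : S) (T : measurableType d)
    (P : probability T R)
    (phi : T -> (primal_data m u * dual_data m u) * (horizon m).-tuple E)
    (s : 'I_(horizon m) ->
         (primal_data m u * dual_data m u) * (horizon m).-tuple E -> R) :
  dynamic_programming m -> assumption_B1 m u -> assumption_B2 m u ->
  measurable_fun setT phi ->
  (forall B, measurable B -> P (phi @^-1` B) = overall_law m u B) ->
  (forall t, measurable_fun setT (s t)) -> (forall t w, 0 <= s t w)%R ->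
  (forall t, {ae overall_law m u, forall w, forall z,
     (`|eta_star u t z (tnth w.2 t) - eta_tilde t w.1 z (tnth w.2 t)|
        <= s t w)%R}) ->
  exists D : T -> R, [/\ measurable_fun setT D,
    'N[P]_2%:E[EFin \o D]
      <= 'N[overall_law m u]_2%:E[EFin \o (fun w => \sum_t s t w)%R] &
    {ae P, forall w, esssup P
       (fun a w => (pathwise x a (phi w).1 (phi w).2)%:E) w
         = (Vstar m 0 x + D w)%:E}].
Proof.
move=> DP B1 B2 mphi phiP ms s0 etas.
pose h w := (\sum_t s t w)%R.
have mh : measurable_fun setT h by exact: measurable_sum.
have h0 w : (0 <= h w)%R by exact: sumr_ge0.
have band : {ae P, forall w,
    (forall a, pathwise x a (phi w).1 (phi w).2 <= Vstar m 0 x + h (phi w))%R /\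
    forall y, (forall a, (pathwise x a (phi w).1 (phi w).2)%:E <= y) ->
      (Vstar m 0 x - h (phi w))%:E <= y}.
  (* There are finitely many times [t], so their null sets merge into one. *)
  have : {ae overall_law m u, forall w t z,
     (`|eta_star u t z (tnth w.2 t) - eta_tilde t w.1 z (tnth w.2 t)|
        <= s t w)%R} by exact: filter_forall.
  move/(ae_comp mphi phiP); apply: filterS => w ets.
  exact: pathwise_band ets.
have mhphi : measurable_fun setT (h \o phi) by exact: measurableT_comp.
have [D [mD Dh DE]] := esssup_band mhphi (fun w => h0 (phi w)) band.
exists D; split=> //; rewrite -(Lnorm2_comp mphi phiP mh).
by apply: le_Lnorm2 => // w; rewrite [leRHS]ger0_norm ?h0.
Qed.

(** * The bounds in expectation and in mean square *)

Theorem mainTheorem3 (R : realType) (dS dA dE : measure_display)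
    (S : measurableType dS) (A : measurableType dA) (E : measurableType dE)
    (m : mdp R S A) (u : setup R S A E)
    (hDP : dynamic_programming m)
    (hB1 : assumption_B1 m u) (hB2 : assumption_B2 m u)
    (hB3 : assumption_B3 m u) (hB4 : assumption_B4 u)
    (x : S) :
  V_up m u x - (Vstar m 0 x)%:E
    <= \sum_(t < horizon m) eta_error m u t
  /\
  forall Ntest : nat, (1 <= Ntest)%N ->
    (\int[test_law m u Ntest]_w
       (`|V_up_test m u Ntest x w - (Vstar m 0 x)%:E| ^+ 2)) `^ 2^-1
    <= ((Num.sqrt Ntest%:R)^-1 + 1)%:E
       * \sum_(t < horizon m) eta_error m u t.
Proof.
have c1 n : (1 <= (Num.sqrt n%:R)^-1 + 1 :> R)%R.
  by rewrite lerDr invr_ge0 sqrtr_ge0.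
have err0 t : 0 <= eta_error m u t by exact: poweR_ge0.
(* An infinite error sum makes both right-hand sides [+oo]. Otherwise every single error is finite,
   as [sqrt_majorant] requires. *)
have [erry|] := eqVneq (\sum_(t < horizon m) eta_error m u t) +oo.
  rewrite erry; split=> [|n _]; first exact: leey.
  by rewrite gt0_muley ?leey// lte_fin (lt_le_trans _ (c1 n)).
rewrite esum_eqy => [|t _]; last by rewrite gt_eqF// (lt_le_trans _ (err0 t)).
rewrite negb_exists => /forallP erry.
pose f t (z : S * A) (w : (primal_data m u * dual_data m u)
    * (horizon m).-tuple E) : R :=
  (eta_star u t z (tnth w.2 t) - eta_tilde t w.1 z (tnth w.2 t))%R.
pose G t := esssup (overall_law m u) (fun z w => (`|f t z w| ^+ 2)%:E).
pose z0 := (x, tnth (gridA u) (Ordinal (L_gt0 u))).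
have /choice[s hs] t : exists s : _ -> R, [/\ measurable_fun setT s,
    forall w, (0 <= s w)%R,
    {ae overall_law m u, forall w, forall z, (`|f t z w| <= s w)%R} &
    'N[overall_law m u]_2%:E[EFin \o s] = eta_error m u t].
  have [mG fG _] := esssupP (overall_law m u) (fun z w => (`|f t z w| ^+ 2)%:E).
  apply: (sqrt_majorant z0 mG fG); apply: (@lty_poweRy _ _ 2^-1) => //.
  by rewrite ltey; exact: erry t.
have ms t : measurable_fun setT (s t) by case: (hs t).
have s0 t w : (0 <= s t w)%R by case: (hs t).
have fs t : {ae overall_law m u, forall w, forall z, (`|f t z w| <= s t w)%R}.
  by case: (hs t).
have hN : 'N[overall_law m u]_2%:E[EFin \o (fun w => \sum_t s t w)%R]
    <= \sum_(t < horizon m) eta_error m u t.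
  apply: le_trans (Lnorm2_sum _ ms) _; apply: lee_sum => t _.
  by case: (hs t) => _ _ _ ->.
have errlty : \sum_(t < horizon m) eta_error m u t < +oo.
  by apply: lte_sum_pinfty => t _; rewrite ltey; exact: erry t.
split.
  have [D [mD DN DE]] := dual_deviation x hDP hB1 hB2 (@measurable_id _ _ setT)
    (fun B _ => erefl) ms s0 fs.
  have iD : (overall_law m u).-integrable setT (EFin \o D).
    by apply: integrable_Lnorm2_lty => //; exact: le_lt_trans (le_trans DN hN) _.
  rewrite /V_up (ae_eq_integral (fun w => (Vstar m 0 x)%:E + (D w)%:E))//.
  - have ic := finite_measure_integrable_cst (overall_law m u) (Vstar m 0 x)
      measurableT.
    rewrite (integralD measurableT ic iD) /= integral_cst//.
    rewrite [X in _ * X]probability_setT mule1 addeAC subee// add0e.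
    (* The integral of [D] is at most its L^1 norm, which is at most its L^2 norm. *)
    apply: le_trans (le_trans DN hN).
    apply: le_trans (Lnorm1_le_Lnorm2 _ mD); rewrite Lnorm1.
    apply: le_trans (lee_abs _) _; apply: le_abse_integral => //.
    exact/measurable_EFinP.
  - by case: (esssupP (overall_law m u) (fun a w => (pathwise x a w.1 w.2)%:E)).
  - apply: emeasurable_funD => //; exact/measurable_EFinP.
  - by apply: filterS DE => w -> _.
(* The prefactor is at least [1], so bounding by the error sum alone suffices. *)
move=> n n0; apply: (@le_trans _ _ (\sum_(t < horizon m) eta_error m u t)); last first.
  by rewrite lee_pemull ?sume_ge0// lee_fin.
have /choice[D hD] (i : 'I_n) := dual_deviation x hDP hB1 hB2
  (proj1 (test_law_tnth m u i)) (proj2 (test_law_tnth m u i)) ms s0 fs.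
have mD i : measurable_fun setT (D i) by case: (hD i).
have mnD i : measurable_fun setT (fun w => n%:R^-1 * D i w)%R.
  by apply: measurable_funM.
(* Almost surely, [Y] is the deviation of the Monte Carlo average from [Vstar m 0 x], since [n]
   copies of this constant average back to it. *)
pose Y w := (\sum_(i < n) n%:R^-1 * D i w)%R.
have nn : (n%:R != 0 :> R)%R by rewrite pnatr_eq0 -lt0n.
rewrite (ae_eq_integral (fun w => (Y w ^+ 2)%:E))//; first last.
- have : {ae test_law m u n, forall w, forall i,
      esssup (test_law m u n) (fun a w => (pathwise x a w.1 (tnth w.2 i))%:E) w
      = (Vstar m 0 x + D i w)%:E}.
    by apply: filter_forall => i; case: (hD i).
  apply: filterS => w hw _; rewrite /V_up_test (eq_bigr _ (fun i _ => hw i)).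
  rewrite sumEFin -EFinM -EFinB -EFin_expe -[in RHS]real_normK ?num_real//.
  congr ((`|_| ^+ 2)%:E)%R; rewrite /Y -mulr_sumr big_split /= sumr_const card_ord.
  by rewrite mulrDr -[(Vstar _ _ _ *+ _)%R]mulr_natl mulKf// addrC addKr.
- apply/measurable_EFinP/measurable_funX; exact: measurable_sum.
- have mV : measurable_fun setT (fun w =>
      `|V_up_test m u n x w - (Vstar m 0 x)%:E|).
    apply: measurableT_comp => //; apply: emeasurable_funB => //.
    apply: emeasurable_funM => //; apply: emeasurable_sum => i.
    by case: (esssupP (test_law m u n)
      (fun a w => (pathwise x a w.1 (tnth w.2 i))%:E)).
  under eq_fun do rewrite expeS expeS expe0 mule1.
  exact: emeasurable_funM.
rewrite -Lnorm2E; apply: le_trans (Lnorm2_sum _ mnD) _.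
(* By the triangle inequality each test path contributes at most a share [1/n] of the error sum. *)
apply: (@le_trans _ _ (\sum_(i < n) n%:R^-1%:E *
    \sum_(t < horizon m) eta_error m u t)).
  apply: lee_sum => i _; rewrite Lnorm2Z// lee_wpmul2l ?lee_fin//.
  by case: (hD i) => _ + _ => /le_trans; exact.
rewrite -ge0_sume_distrl// sumEFin sumr_const card_ord -[(_ *+ _)%R]mulr_natr.
by rewrite mulVf// mul1e.
Qed.
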